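(* Let $c<8/7$. On instances fulfilling $p_j= p$ for all jobs $j$ (for some common $p\in\mathbb{N}$), there does not exist a $c$-competitive (deterministic) algorithm for the preemptive semi-online machine minimization problem.
   Context: Machine minimization with deadlines: each job $j$ of a finite instance has integer release date $r_j$, processing time $p_j$ and deadline $d_j$. A feasible preemptive schedule on a given number of identical machines processes each job for $p_j$ units within $[r_j,d_j]$, each machine processing at most one job at a time, no job on two machines at once; preemption and migration allowed. $m$ is the minimum number of machines admitting a feasible schedule. Semi-online: each job becomes known only at its release date, the algorithm makes its decisions over time, and $m$ is known in advance. An algorithm is $c$-competitive if on every instance it produces a feasible schedule using at most $c\cdot m$ machines. *)

(* Defs.v *)
(* MathComp / MathComp-Analysis *)
From mathcomp Require Import all_boot all_order all_algebra.
From mathcomp Require Import all_classical all_reals all_analysis.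
Set Implicit Arguments.
Unset Strict Implicit.
Unset Printing Implicit Defensive.
Import Order.TTheory GRing.Theory Num.Theory.
Local Open Scope classical_set_scope.
Local Open Scope ring_scope.

Record job := Job { release : int; proc : nat; deadline : int }.

(* An instance is listed in the order in which its jobs are presented. The name
   of a job is its position in the list, so identical jobs stay distinct; as
   the list is sorted by release date, the jobs known at any time form a prefix
   of it and a name does not depend on jobs released later. *)
Definition is_instance (I : seq job) : bool :=
  sorted (fun a b => release a <= release b) I.

Definition job_at (I : seq job) (j : nat) : job := nth (Job 0 0 0) I j.

Definition equal_processing (I : seq job) : Prop :=
  exists2 p : nat, (0 < p)%N & all (fun a => proc a == p) I.

Section Schedules.
Variable R : realType.

(* [S i t = Some j] means that machine [i] processes job [j] at time [t];
   [None] means that it is idle. Time is continuous, and a job may be preempted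
   and migrated arbitrarily often, as long as the sets of times are
   measurable. *)
Definition schedule := nat -> R -> option nat.

Definition processed_at (S : schedule) (j : nat) : set R :=
  [set t | exists i, S i t = Some j].

(* Feasibility on the [k] machines 0, ..., k - 1. *)
Record feasible (I : seq job) (k : nat) (S : schedule) : Prop := Feasible {
  only_machines : forall i t, (k <= i)%N -> S i t = None;
  in_window : forall i t j, S i t = Some j ->
    (j < size I)%N /\
    (release (job_at I j))%:~R <= t <= (deadline (job_at I j))%:~R;
  one_machine_per_job : forall i i' t j,
    S i t = Some j -> S i' t = Some j -> i = i';
  measurable_processing : forall i j, measurable [set t | S i t = Some j];
  processing_complete : forall j, (j < size I)%N ->
    lebesgue_measure (processed_at S j) = ((proc (job_at I j))%:R)%:E
}.

(* No [m] satisfies this when the window of some job is too short for it. *)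
Definition is_opt (I : seq job) (m : nat) : Prop :=
  (exists S, feasible I m S) /\
  (forall k S, feasible I k S -> (m <= k)%N).

Definition known (I : seq job) (t : R) : seq job :=
  [seq a <- I | (release a)%:~R <= t].

(* A deterministic semi-online algorithm: [A m t K i] is what machine [i] does
   at time [t] when the optimum is [m] and [K] lists the jobs released up to
   time [t]. The algorithm being deterministic, its own earlier decisions are a
   function of [m] and [K], so they need not be an argument. *)
Definition algorithm := nat -> R -> seq job -> nat -> option nat.

Definition run (A : algorithm) (m : nat) (I : seq job) : schedule :=
  fun i t => A m t (known I t) i.

Definition competitive_on (C : seq job -> Prop) (c : R) (A : algorithm) : Prop :=
  forall (I : seq job) (m : nat), is_instance I -> C I -> is_opt I m ->
    exists2 k : nat, k%:R <= c * m%:R & feasible I k (run A m I).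

End Schedules.

(* Main.v *)
(** Already on instances of optimum 2 an algorithm would have to use exactly the
    optimal number of machines, since [c * 2 < 16/7 < 3]. Release at time 0 two
    jobs with window [0, 4] and one job [C] with window [0, 7], all of length 2.
    If two jobs with window [2, 4] follow, then the four other jobs fill both
    machines during [0, 4], so the algorithm cannot have touched [C] before time
    2. But before then it cannot rule out that instead two jobs with window
    [3, 5] and two with window [5, 7] follow; these fill both machines during
    [3, 7], and [C], untouched before time 2, gets at most 1 unit, during
    [2, 3]. *)

Require Import Defs.
From mathcomp Require Import all_boot all_order all_algebra.
From mathcomp Require Import all_classical all_reals all_analysis.
From mathcomp Require Import lra.
Set Implicit Arguments.
Unset Strict Implicit.
Unset Printing Implicit Defensive.
Local Open Scope ring_scope.

(** * Volume bounds for feasible schedules *)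

Section Volume.
Import Order.TTheory GRing.Theory Num.Theory.
Local Open Scope classical_set_scope.
Context {R : realType}.
Implicit Types (I : seq job) (S : schedule R) (W : set R).
Local Notation mu := (@lebesgue_measure R).

Lemma measure_bigcup_seq (s : seq nat) (F : nat -> set R) :
    uniq s -> (forall j, measurable (F j)) -> trivIset setT F ->
  mu (\bigcup_(j in [set` s]) F j) = (\sum_(j <- s) mu (F j))%E.
Proof.
move=> us mF tF; rewrite fsbig_seq//.
rewrite measure_fin_bigcup//; first exact: finite_seq.
  exact: sub_trivIset tF.
by move=> j _; exact: mF.
Qed.

Lemma measurable_processed_at I k S j :
  feasible I k S -> measurable (processed_at S j).
Proof.
case=> _ _ _ mS _.
have -> : processed_at S j = \bigcup_i [set t | S i t = Some j].
  by apply/seteqP; split=> [t [i it]|t [i _ it]]; exists i.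
exact: bigcup_measurable.
Qed.

Lemma processed_at_window I k S j : feasible I k S ->
  processed_at S j `<=`
  `[(release (job_at I j))%:~R, (deadline (job_at I j))%:~R].
Proof. by case=> _ w _ _ _ t [i /w [_ ?]]; rewrite /= in_itv. Qed.

(** Each machine contributes at most [mu W]: the sets of times at which it processes distinct jobs
    are disjoint. Splitting each job over the [k] machines and exchanging the two sums gives the
    bound. *)
Lemma processed_volume_le I k S (s : seq nat) W :
    feasible I k S -> uniq s -> measurable W ->
  (\sum_(j <- s) mu (processed_at S j `&` W) <= \sum_(i < k) mu W)%E.
Proof.
move=> [km _ _ mS _] us mW.
pose Q i j := [set t | S i t = Some j] `&` W.
have mQ i j : measurable (Q i j) by exact: measurableI.
apply: (@le_trans _ _ (\sum_(j <- s) \sum_(i < k) mu (Q i j))%E).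
  apply: lee_sum => j _.
  have -> : processed_at S j `&` W = \big[setU/set0]_(i < k) Q i j.
    rewrite -(bigcup_mkord k (Q^~ j)); apply/seteqP.
    split=> [t [[i it] Wt]|t [i _ [it Wt]]].
      exists i => //=; rewrite ltnNge; apply/negP => /(km i t).
      by rewrite it.
    by split => //; exists i.
  by apply: (@le_mu_bigsetU _ _ _ mu (Q^~ j) k) => i _; exact: mQ.
rewrite exchange_big /=; apply: lee_sum => i _.
rewrite -measure_bigcup_seq//; last first.
  by move=> j j' _ _ [t [[/= Sj _] [/= Sj' _]]]; move: Sj; rewrite Sj' => -[].
apply: le_measure; rewrite ?inE//.
  by apply: bigcup_measurable => j _; exact: mQ.
by move=> t [j _ []].
Qed.

(** The jobs in [s] are confined to [[a, b]], so their whole processing counts there; the capacity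
    they leave bounds what [j], whose window may be wider, can receive in [[a, b]]. *)
Lemma window_volume_le I k S (s : seq nat) (j : nat) (a b : int) :
    feasible I k S -> uniq (j :: s) -> a <= b ->
    all (fun x => [&& (x < size I)%N, a <= release (job_at I x) &
                      deadline (job_at I x) <= b]) s ->
  ((\sum_(x <- s) proc (job_at I x))%:R%:E +
     mu (processed_at S j `&` `[a%:~R, b%:~R]) <= (k%:R * (b - a)%:~R)%:E)%E.
Proof.
move=> fS us ab ws; set W := `[a%:~R, b%:~R].
have muW : mu W = (b - a)%:~R%:E.
  rewrite lebesgue_measure_itv/= lte_fin ltr_int rmorphB/=.
  case: ltP => // ba; have -> : a = b by apply/le_anti; rewrite ab ba.
  by rewrite subrr.
have := processed_volume_le fS us (measurable_itv _ : measurable W).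
rewrite big_cons muW addeC sumEFin sumr_const card_ord mulr_natl.
apply: le_trans; apply: leeD => //.
rewrite natr_sum -sumEFin big_seq [leRHS]big_seq.
apply: lee_sum => x /(allP ws)/and3P[xI ax xb].
rewrite -(processing_complete fS xI) setIidl//.
move=> t /(processed_at_window fS); rewrite /W/= !in_itv/= => /andP[rt td].
by rewrite (le_trans _ rt) ?ler_int//= (le_trans td) ?ler_int.
Qed.

End Volume.

(** * Schedules that are constant on unit time slots *)

Section SlotSchedules.
Import Order.TTheory GRing.Theory Num.Theory.
Local Open Scope classical_set_scope.
Context {R : realType}.

(** The guard keeps negative times idle: [Num.truncn] sends them to 0, which would stretch slot 0
    over the whole negative axis. *)
Definition slot_schedule (T : nat -> nat -> option nat) : schedule R :=
  fun i t => if 0 <= t then T i (Num.truncn t) else None.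

Definition slots (P : pred nat) (h : nat) : set R :=
  \bigcup_(n in [set` [seq n <- iota 0 h | P n]]) `[n%:R, n.+1%:R[.

Lemma measurable_slots P h : measurable (slots P h).
Proof. by apply: bigcup_measurable. Qed.

Lemma measure_slots P h :
  lebesgue_measure (slots P h) = (count P (iota 0 h))%:R%:E.
Proof.
rewrite measure_bigcup_seq ?filter_uniq ?iota_uniq//; last first.
  move=> n n' _ _ [t [/=]]; rewrite !in_itv/= => tn tn'.
  by rewrite -(truncn_def tn) (truncn_def tn').
rewrite (eq_bigr (fun=> 1%:E)) => [|n _]; last first.
  rewrite lebesgue_measure_itv/= lte_fin ltr_nat ltnS leqnn.
  by rewrite -EFinB -natrB// subSnn.
by rewrite sumEFin big_const_seq count_predT iter_addr_0 size_filter.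
Qed.

Lemma slotsP (P : pred nat) h (t : R) : (forall n, P n -> (n < h)%N) ->
  slots P h t <-> 0 <= t /\ P (Num.truncn t).
Proof.
move=> Ph; split=> [[n /=]|[t0 Pt]].
  rewrite mem_filter => /andP[Pn _]; rewrite in_itv/= => tn.
  rewrite (truncn_def tn); split => //.
  by case/andP: tn => + _; apply: le_trans.
exists (Num.truncn t) => /=; last by rewrite in_itv/= truncn_itv.
by rewrite mem_filter Pt mem_iota/= add0n Ph.
Qed.

(** Turns feasibility into conditions on a finite table, settled by case analysis and computation;
    the measure of a job's processing becomes a count of slots. *)
Lemma slot_schedule_feasible I k h (T : nat -> nat -> option nat) :
    (forall i n j, T i n = Some j -> (i < k)%N /\ (n < h)%N) ->
    (forall i n j, T i n = Some j -> [&& (j < size I)%N,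
       release (job_at I j) <= n%:Z & n.+1%:Z <= deadline (job_at I j)]) ->
    (forall i i' n j, T i n = Some j -> T i' n = Some j -> i = i') ->
    (forall j, (j < size I)%N ->
       count (fun n => has (fun i => T i n == Some j) (iota 0 k)) (iota 0 h)
       = proc (job_at I j)) ->
  feasible I k (slot_schedule T).
Proof.
move=> Tkh Tw Tone Tproc; rewrite /slot_schedule; split.
- move=> i t ki; case: ifP => // _; case E: (T i _) => [j|//].
  by have [] := Tkh _ _ _ E; rewrite ltnNge ki.
- move=> i t j; case: ifP => // t0 /Tw/and3P[jI rj dj]; split => //.
  have /andP[t1 t2] := truncn_itv t0.
  rewrite (le_trans _ t1); last by rewrite pmulrn ler_int.
  by rewrite (le_trans (ltW t2))// pmulrn ler_int.
- by move=> i i' t j; case: ifP => // _; apply: Tone.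
- move=> i j.
  have -> : [set t : R |
      (if 0 <= t then T i (Num.truncn t) else None) = Some j] = slots (fun n => T i n == Some j) h.
    apply/seteqP; split=> t /=; rewrite slotsP.
    + by case: ifP => // _ /eqP.
    + by move=> n /eqP/Tkh[].
    + by case=> -> /eqP.
    + by move=> n /eqP/Tkh[].
  exact: measurable_slots.
- move=> j jI; rewrite -Tproc// -measure_slots; congr lebesgue_measure.
  have hasP' n : has (fun i => T i n == Some j) (iota 0 k) <->
      exists i, T i n = Some j.
    split=> [/hasP[i _ /eqP ?]|[i Ti]]; first by exists i.
    apply/hasP; exists i; last exact/eqP.
    by rewrite mem_iota; case: (Tkh _ _ _ Ti).
  have bound n : has (fun i => T i n == Some j) (iota 0 k) -> (n < h)%N.
    by move=> /hasP' [i /Tkh[]].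
  apply/seteqP; split=> t; rewrite slotsP// hasP'.
    by case=> i /=; case: ifP => // t0 Ti; split=> //; exists i.
  by case=> t0 [i Ti]; exists i; rewrite t0.
Qed.

End SlotSchedules.

(** * The two instances and the contradiction between them *)

Definition base_jobs : seq job := [:: Job 0 2 4; Job 0 2 4; Job 0 2 7].

Definition early_jobs : seq job := [:: Job 2 2 4; Job 2 2 4].

Definition late_jobs : seq job :=
  [:: Job 3 2 5; Job 3 2 5; Job 5 2 7; Job 5 2 7].

Section LowerBound.
Import Order.TTheory GRing.Theory Num.Theory.
Local Open Scope classical_set_scope.
Context {R : realType}.
Local Notation mu := (@lebesgue_measure R).
Local Notation early := (base_jobs ++ early_jobs).
Local Notation late := (base_jobs ++ late_jobs).

Definition early_table (i n : nat) : option nat :=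
  match i with
  | 0 => nth None [seq Some j | j <- [:: 0; 0; 3; 3; 2; 2]] n
  | 1 => nth None [seq Some j | j <- [:: 1; 1; 4; 4]] n
  | _ => None
  end%N.

(** Jobs 0, 1 and 2 must fill both machines during [[0, 3]] to leave [[3, 7]] to the late jobs;
    hence job 1 is preempted after slot 0 and migrates to machine 0 for slot 2. *)
Definition late_table (i n : nat) : option nat :=
  match i with
  | 0 => nth None [seq Some j | j <- [:: 0; 0; 1; 3; 3; 5; 5]] n
  | 1 => nth None [seq Some j | j <- [:: 1; 2; 2; 4; 4; 6; 6]] n
  | _ => None
  end%N.

Lemma early_feasible : feasible early 2 (@slot_schedule R early_table).
Proof.
apply: (@slot_schedule_feasible _ _ _ 6).
- by move=> [|[|i]] [|[|[|[|[|[|n]]]]]] j //=; rewrite ?nth_nil.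
- by move=> [|[|i]] [|[|[|[|[|[|n]]]]]] j //=;
    rewrite ?nth_nil // => -[<-].
- by move=> [|[|i]] [|[|i']] [|[|[|[|[|[|n]]]]]] j //=;
    rewrite ?nth_nil // => -[<-].
- by move=> [|[|[|[|[|j]]]]].
Qed.

Lemma late_feasible : feasible late 2 (@slot_schedule R late_table).
Proof.
apply: (@slot_schedule_feasible _ _ _ 7).
- by move=> [|[|i]] [|[|[|[|[|[|[|n]]]]]]] j //=; rewrite ?nth_nil.
- by move=> [|[|i]] [|[|[|[|[|[|[|n]]]]]]] j //=;
    rewrite ?nth_nil // => -[<-].
- by move=> [|[|i]] [|[|i']] [|[|[|[|[|[|[|n]]]]]]] j //=;
    rewrite ?nth_nil // => -[<-].
- by move=> [|[|[|[|[|[|[|j]]]]]]].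
Qed.

(** Job 2 is [C]; the other four jobs have total length 8 and windows inside [[0, 4]]. *)
Lemma early_volume k (S : schedule R) : feasible early k S ->
  (8%:R%:E + mu (processed_at S 2 `&` [set` `[0, 4]%R]) <= (k%:R * 4%:R)%:E)%E.
Proof.
move=> fS.
have := window_volume_le (s := [:: 0; 1; 3; 4]%N) (j := 2) (a := 0) (b := 4) fS
  isT isT isT.
by rewrite !big_cons big_nil.
Qed.

Lemma late_volume k (S : schedule R) : feasible late k S ->
  (8%:R%:E + mu (processed_at S 2 `&` [set` `[3, 7]%R]) <= (k%:R * 4%:R)%:E)%E.
Proof.
move=> fS.
have := window_volume_le (s := [:: 3; 4; 5; 6]%N) (j := 2) (a := 3) (b := 7) fS
  isT isT isT.
by rewrite !big_cons big_nil.
Qed.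

(** Two machines offer 8 units in a window of length 4, all taken by the four confined jobs, so the
    time [x] left for [C] is null. *)
Lemma full_volume_idle (k : nat) (x : \bar R) : (k <= 2)%N -> (0 <= x)%E ->
  (8%:R%:E + x <= (k%:R * 4%:R)%:E)%E -> x = 0%E.
Proof.
move=> k2 x0 h; apply/le_anti; rewrite x0 andbT.
have {}h : (8%:R%:E + x <= 8%:R%:E)%E.
  apply: le_trans h _; rewrite lee_fin -natrM ler_nat.
  by rewrite (leq_mul2r 4 k 2).
by move: h; rewrite -[leRHS]adde0 leeD2lE.
Qed.

Lemma full_volume_machines (k : nat) (x : \bar R) : (0 <= x)%E ->
  (8%:R%:E + x <= (k%:R * 4%:R)%:E)%E -> (2 <= k)%N.
Proof.
move=> x0 h; rewrite -(leq_pmul2r (isT : 0 < 4)%N) -(ler_nat R) -lee_fin.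
by rewrite [in leRHS]natrM (le_trans _ h)// leeDl.
Qed.

Lemma early_opt : is_opt R early 2.
Proof.
split; first by exists (slot_schedule early_table); exact: early_feasible.
by move=> k S /early_volume; apply: full_volume_machines.
Qed.

Lemma late_opt : is_opt R late 2.
Proof.
split; first by exists (slot_schedule late_table); exact: late_feasible.
by move=> k S /late_volume; apply: full_volume_machines.
Qed.

Lemma known_base (J : seq job) (t : R) : all (fun a => 2 <= release a) J ->
  t < 2%:R -> known (base_jobs ++ J) t = known base_jobs t.
Proof.
move=> J2 t2; rewrite /known filter_cat -[RHS]cats0; congr (_ ++ _).
elim: J J2 => //= a J IH /andP[ra /IH ->]; rewrite ifN// -ltNge.
by apply: lt_le_trans t2 _; rewrite (ler_int R 2).
Qed.

(** Both instances have optimum 2 and the same known jobs before time 2, so the algorithm cannot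
    tell them apart. *)
Lemma processed_at_run_eq (A : algorithm R) j (t : R) : t < 2%:R ->
  processed_at (run A 2 early) j t <-> processed_at (run A 2 late) j t.
Proof.
by move=> t2; split=> -[i it]; exists i; move: it; rewrite /run !known_base.
Qed.

Lemma two_machines_fail (A : algorithm R) (k1 k2 : nat) :
    (k1 <= 2)%N -> (k2 <= 2)%N ->
  feasible early k1 (run A 2 early) -> ~ feasible late k2 (run A 2 late).
Proof.
move=> k12 k22 f1 f2.
set P := processed_at (run A 2 early) 2 in f1.
set Q := processed_at (run A 2 late) 2.
have mP : measurable P := measurable_processed_at 2 f1.
have mQ : measurable Q := measurable_processed_at 2 f2.
have P0 := full_volume_idle k12 (measure_ge0 _ _) (early_volume f1).
have Q0 := full_volume_idle k22 (measure_ge0 _ _) (late_volume f2).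
have Q2 : lebesgue_measure Q = 2%:R%:E := processing_complete f2 (j := 2) isT.
(* Before time 2 the set [Q] agrees with [P], so [U] covers [Q]. By [P0] and [Q0] its outer pieces
   are null, leaving measure at most 1, the length of [[2, 3]], while [C] needs 2. *)
pose U := (P `&` `[0, 4]) `|` `[2, 3] `|` (Q `&` `[3, 7]).
have mU : measurable U by do ?[apply: measurableU|apply: measurableI].
have cover : Q `<=` U.
  move=> t Qt; have := processed_at_window f2 Qt.
  rewrite /= in_itv/= => /andP[t0 t7].
  have [t2|t2] := ltP t 2%:R.
    left; left; split; first exact/(processed_at_run_eq _ _ t2).
    by rewrite /= in_itv/= t0/=; lra.
  have [t3|t3] := leP t 3%:R; first by left; right; rewrite /= in_itv/= t2.
  by right; split=> //; rewrite /= in_itv/= ltW.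
have : (lebesgue_measure Q <= 1%:E)%E.
  apply: (@le_trans _ _ (mu U)); first by apply: le_measure; rewrite ?inE.
  rewrite measureU0//; last 2 first.
  - by do ?[apply: measurableU|apply: measurableI].
  - exact: measurableI.
  apply: le_trans (measureU2 _ _ _) _ => //; first exact: measurableI.
  rewrite [X in (X + _)%E]P0 add0e.
  have mu23 : (mu ([set` `[2, 3]%R] : set R) <= 1%:E)%E.
    rewrite lebesgue_measure_itv/= lte_fin.
    by case: ifP => _; rewrite lee_fin; lra.
  exact: mu23.
rewrite Q2 lee_fin; lra.
Qed.

End LowerBound.

Theorem theorem9 (R : realType) (c : R) (hc : c < 8%:R / 7%:R) :
  ~ exists A : algorithm R, competitive_on equal_processing c A.
Proof.
move=> [A comp].
have feasible2 J : is_instance J -> equal_processing J -> is_opt R J 2 ->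
    exists2 k : nat, (k <= 2)%N & feasible J k (run A 2 J).
  move=> sJ pJ oJ; have [k kc fk] := comp _ _ sJ pJ oJ; exists k => //.
  by rewrite -ltnS -(Num.Theory.ltr_nat R); lra.
have [||k1 k12 f1] := feasible2 _ _ _ early_opt; first by [].
  by exists 2%N.
have [||k2 k22 f2] := feasible2 _ _ _ late_opt; first by [].
  by exists 2%N.
exact: two_machines_fail k12 k22 f1 f2.
Qed.
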